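(* Let $G$ be a finite group. Then $\eta(G)=1$ if and only if $G$ is trivial; and $\eta(G)=2$ if and only if $G$ is nontrivial of prime exponent.
   Context: For a finite group $G$, $\omega(G)$ denotes the set of orders of elements of $G$ and $\eta(G)=|\omega(G)|$. The exponent of $G$ is the least common multiple of the orders of its elements. *)

(* Defs.v *)
From mathcomp Require Import all_boot all_fingroup all_solvable.

Set Implicit Arguments.
Unset Strict Implicit.
Unset Printing Implicit Defensive.

(* Duplicate-free enumeration, so that its size is the cardinality of the set
   of element orders. *)
Definition omega (gT : finGroupType) (G : {group gT}) : seq nat :=
  undup [seq #[x]%g | x in G].

Definition eta (gT : finGroupType) (G : {group gT}) : nat := size (omega G).

(* Main.v *)
Require Import Defs.
From mathcomp Require Import all_boot all_fingroup all_solvable.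

(** The set of element orders contains 1 (the order of the identity) and is
    closed under divisors, since a suitable power of an element of order [d]
    has any prescribed order [e] dividing [d]; this is [dvdn_mem_omega].
    It is thus a singleton exactly when every element has order 1.  If it is a
    pair, it is [{1, m}] with [m] different from 1; the least prime divisor of
    [m] is also an element order, so [m] is that prime, and the exponent, being
    the least common multiple of 1 and [m], is [m].  Conversely, if the exponent
    is a prime [p], every element order divides [p], and [p] itself occurs
    because a group of exponent different from 1 has a non-identity element. *)

Lemma omegaP (gT : finGroupType) (G : {group gT}) (d : nat) :
  reflect (exists2 x, x \in G & d = #[x]%g) (d \in omega G).
Proof. by rewrite mem_undup; apply: (iffP imageP). Qed.

Lemma mem_omega1 (gT : finGroupType) (G : {group gT}) : 1 \in omega G.
Proof. by apply/omegaP; exists 1%g; rewrite ?group1 ?order1. Qed.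

Lemma dvdn_mem_omega (gT : finGroupType) (G : {group gT}) (d e : nat) :
  e %| d -> d \in omega G -> e \in omega G.
Proof.
move=> e_dv_d /omegaP[x Gx def_d]; rewrite {}def_d in e_dv_d.
apply/omegaP; exists (x ^+ (#[x] %/ e))%g; first exact: groupX.
by rewrite orderXdiv ?dvdn_div // divnA // mulKn.
Qed.

(** Element orders determine the exponent as their least common multiple;
    here it is characterised by the numbers it divides. *)
Lemma exponent_dvdn_omega (gT : finGroupType) (G : {group gT}) (n : nat) :
  reflect {in omega G, forall d, d %| n} (exponent G %| n).
Proof.
apply: (iffP exponentP) => [expG _ /omegaP[x Gx ->] | expG x Gx].
  by rewrite order_dvdn expG.
by apply/eqP; rewrite -order_dvdn expG //; apply/omegaP; exists x.
Qed.

Lemma trivg_sub_omega1 (gT : finGroupType) (G : {group gT}) :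
  G :=: 1%g <-> {subset omega G <= [:: 1]}.
Proof.
split=> [G1 _ /omegaP[x Gx ->] | sub1].
  by move: Gx; rewrite G1 => /set1P->; rewrite order1.
apply/eqP; rewrite trivg_exponent; apply/exponent_dvdn_omega => d /sub1.
by rewrite inE => /eqP->.
Qed.

Lemma eta_eq1 (gT : finGroupType) (G : {group gT}) : eta G = 1 <-> G :=: 1%g.
Proof.
apply: iff_trans (iff_sym (trivg_sub_omega1 _ G)); rewrite /eta; split=> [eta1 d | sub1].
  have := mem_omega1 _ G; case: (omega G) eta1 => [|a [|]] //= _.
  by rewrite !inE => /eqP <-.
apply/eqP; rewrite eqn_leq (uniq_leq_size (undup_uniq _) sub1) /=.
by case: (omega G) (mem_omega1 _ G).
Qed.

(** Closure under divisors forces the second element order to be prime. *)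
Lemma eta2_prime_exponent (gT : finGroupType) (G : {group gT}) :
  eta G = 2 -> prime (exponent G).
Proof.
move=> eta2.
have [m m_neq1 omegaE]: exists2 m, m != 1 & omega G =i [:: 1; m].
  have := mem_omega1 _ G; have := undup_uniq [seq #[x]%g | x in G].
  rewrite -/(omega G); move: eta2; rewrite /eta.
  case: (omega G) => [|a [|b []]] //= _; rewrite !inE andbT => ab.
  case/orP=> /eqP def1; first by exists b => [|d]; rewrite ?def1 // eq_sym.
  by exists a => [|d]; rewrite def1 // !inE orbC.
have Gm : m \in omega G by rewrite omegaE !inE eqxx orbT.
have m_gt1 : 1 < m.
  by rewrite ltn_neqAle eq_sym m_neq1; have /omegaP[x _ ->] := Gm; apply: order_gt0.
have pr_p := pdiv_prime m_gt1.
have := dvdn_mem_omega _ _ _ _ (pdiv_dvd m) Gm.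
rewrite omegaE !inE (gtn_eqF (prime_gt1 pr_p)) /= => /eqP def_m.
suffices -> : exponent G = m by rewrite -def_m.
apply/eqP; rewrite eqn_dvd; apply/andP; split.
  apply/exponent_dvdn_omega => d.
  by rewrite omegaE !inE => /orP[] /eqP->; rewrite ?dvd1n.
by have /omegaP[x Gx ->] := Gm; apply: dvdn_exponent.
Qed.

(** If the exponent [p] were not itself an element order, all orders would be 1,
    and so would their least common multiple [p]. *)
Lemma prime_exponent_eta2 (gT : finGroupType) (G : {group gT}) :
  prime (exponent G) -> eta G = 2.
Proof.
move=> pr_p; have p_neq1 : 1 != exponent G by rewrite ltn_eqF ?prime_gt1.
have sub_p : {subset omega G <= [:: 1; exponent G]}.
  move=> d /omegaP[x Gx ->]; rewrite !inE.
  by have /primeP[_] := pr_p; apply; apply: dvdn_exponent.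
have Gp : exponent G \in omega G.
  apply: contraR p_neq1 => G'p; rewrite eq_sym -dvdn1.
  apply/exponent_dvdn_omega => d Gd; have := sub_p d Gd.
  by rewrite !inE => /orP[] /eqP def_d; [rewrite def_d | rewrite -def_d Gd in G'p].
apply/eqP; rewrite eqn_leq; apply/andP; split.
  exact: uniq_leq_size (undup_uniq _) sub_p.
apply: (@uniq_leq_size _ [:: 1; exponent G]); first by rewrite /= inE p_neq1.
by move=> d; rewrite !inE => /orP[] /eqP->; rewrite ?mem_omega1.
Qed.

Theorem proposition4p5 (gT : finGroupType) (G : {group gT}) :
  (eta G = 1 <-> G :=: 1%g) /\
  (eta G = 2 <-> G :<>: 1%g /\ prime (exponent G)).
Proof.
split; first exact: eta_eq1.
split=> [eta2 | [_ /prime_exponent_eta2 //]].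
by split; [move/eta_eq1; rewrite eta2 | apply: eta2_prime_exponent].
Qed.
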